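(* Let $S$ be a $\mathbb{Q}$-algebra, $\varphi: S \to R$ a ring morphism, $W \in S$ (also written $W$ for $\varphi(W)$), and $(X,d_X)$ a finite rank matrix factorisation of $W$ over $R$. Let $\mathbf{t} = \{t_1,\ldots,t_n\}$ be a quasi-regular sequence in $R$ such that $R/\mathbf{t}R$ is a finitely generated projective $S$-module, and suppose each $t_j \cdot 1_X$ is null-homotopic, with odd $R$-linear maps $\lambda_j$ on $X$ satisfying $\lambda_j d_X + d_X \lambda_j = t_j \cdot 1_X$. Assume that $R$, viewed as an $S[\mathbf{t}]$-module, admits a standard flat $S$-linear connection. Then there are morphisms in the homotopy category $\mathrm{hf}(S,W)$ \[ \psi: X/\mathbf{t}X \to \varphi_*(X)[n], \qquad \vartheta: \varphi_*(X)[n] \to X/\mathbf{t}X \] with $\psi \circ \vartheta = 1$, and the idempotent $e = \vartheta \circ \psi$ is given by \[ e = \frac{1}{n!} (-1)^{\binom{n+1}{2}} \lambda_1 \cdots \lambda_n \circ \mathrm{At}_{S[\mathbf{t}]/S}(X)^n, \] regarded as an $S$-linear endomorphism of $X/\mathbf{t}X$.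
   Context: All rings are commutative. A linear factorisation of $W \in R$ over $R$ is a $\mathbb{Z}/2$-graded $R$-module $X = X^0 \oplus X^1$ with an odd $R$-linear map $d_X$ satisfying $d_X^2 = W\cdot 1_X$; it is a matrix factorisation if $X^0,X^1$ are free, and finite rank if moreover finitely generated. Morphisms are even maps commuting with the differentials, and two morphisms are homotopic if they differ by $d_Y h + h d_X$ for an odd $h$. $\mathrm{hf}(R,W)$ is the homotopy category of linear factorisations. $X[1]$ is $X$ with the grading shifted by one and differential $-d_X$. For a ring morphism $\varphi: S\to R$ and $W\in S$, $\varphi_*(X)$ is $X$ viewed as an $S$-module via $\varphi$, a linear factorisation of $W$ over $S$. $X/\mathbf{t}X = X \otimes_R R/\mathbf{t}R$ with differential induced by $d_X$; it is a linear factorisation of $W$ over $S$. $S[\mathbf{t}] = S[t_1,\ldots,t_n]$ is the polynomial ring in formal variables, and $R$ is an $S[\mathbf{t}]$-algebra via $t_i \mapsto t_i$. An $S$-linear connection on an $S[\mathbf{t}]$-module $M$ is an $S$-linear map $\nabla^0: M \to M \otimes_{S[\mathbf{t}]} \Omega^1_{S[\mathbf{t}]/S}$ satisfying the Leibniz rule $\nabla^0(am) = a\nabla^0(m) + m \otimes \mathrm{d}a$. For $R$, write $\nabla^0(r) = \sum_j \partial_j(r) \otimes \mathrm{d}t_j$; it is flat if its extension to $R\otimes_{S[\mathbf{t}]}\Omega_{S[\mathbf{t}]/S}$ squares to zero (equivalently the $\partial_j$ commute). It is standard if it is flat and, writing $\delta\nabla^0(r) = \sum_j t_j \partial_j(r)$,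 for every integer $p>0$ the map $r \mapsto p r + \sum_j t_j\partial_j(r)$ is a bijection of $R$ mapping $\mathbf{t}R$ onto $\mathbf{t}R$, and the image of $r \mapsto \sum_j t_j\partial_j(r)$ is $\mathbf{t}R$. Atiyah class: choose an $S$-linear connection $\nabla_X$ on $X$ as an $S[\mathbf{t}]$-module (e.g. $\nabla_X(r\xi_i) = \xi_i \otimes \nabla^0(r)$ for a homogeneous $R$-basis $\{\xi_i\}$). Giving $X\otimes_{S[\mathbf{t}]}\Omega^1_{S[\mathbf{t}]/S}$ the differential $d_X\otimes 1$, the commutator $\mathrm{At}_{S[\mathbf{t}]/S}(X) = [d_X,\nabla_X]$ is an $S[\mathbf{t}]$-linear morphism $X \to X \otimes \Omega^1_{S[\mathbf{t}]/S}[1]$, independent of $\nabla_X$ up to homotopy. Its $n$-fold iterate (composing via $\Omega^i\otimes\Omega^j\to\Omega^{i+j}$) is $\mathrm{At}_{S[\mathbf{t}]/S}(X)^n: X \to X\otimes\Omega^n_{S[\mathbf{t}]/S}[n] \cong X[n]$, trivialising $\Omega^n$ via $\mathrm{d}t_1\wedge\cdots\wedge\mathrm{d}t_n$. Since the $\lambda_j$ and $\mathrm{At}^n$ are $S[\mathbf{t}]$-linear they induce $S$-linear maps on $X/\mathbf{t}X$. *)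

(* Defs.v *)
From HB Require Import structures.
From mathcomp Require Import all_boot all_order all_algebra all_fingroup.
From mathcomp Require Import mpoly.
Set Implicit Arguments. Unset Strict Implicit. Unset Printing Implicit Defensive.
Import Order.TTheory GRing.Theory Num.Theory.
Local Open Scope ring_scope.

Section IdealDefs.
Variables (R : comNzRingType) (n : nat) (t : 'I_n -> R).

Definition inI (x : R) : Prop := exists c : 'I_n -> R, x = \sum_i c i * t i.

Definition is_form (k : nat) (F : {mpoly R[n]}) : bool :=
  all (fun m => mdeg m == k) (msupp F).

(* t is quasi-regular: the natural surjection (R/I)[T_1..T_n] -> gr_I(R)
   is injective, i.e. for every form F of degree k with coefficients in R,
   F(t) in I^(k+1) implies all coefficients of F lie in I.  (I^(k+1) is the
   set of values G(t) of forms G of degree k+1.) *)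
Definition quasi_regular : Prop :=
  forall (k : nat) (F : {mpoly R[n]}), is_form k F ->
    (exists G : {mpoly R[n]}, is_form k.+1 G /\ F.@[t] = G.@[t]) ->
    forall m, inI (F@_m).
End IdealDefs.

Section ConnDefs.
Variables (S : comUnitRingType) (R : comNzRingType) (phi : {rmorphism S -> R}).
Variables (n : nat) (t : 'I_n -> R).

(* R/tR is a finitely generated projective S-module (S acting through phi):
   it is a retract of some free module S^k, via S-linear maps. *)
Definition quot_fg_projective : Prop :=
  exists (k : nat) (iota : R -> 'rV[S]_k) (pi : 'rV[S]_k -> R),
    (forall x y, inI t (x - y) -> iota x = iota y) /\
    (forall s x y, iota (phi s * x + y) = s *: iota x + iota y) /\
    (forall s v w, inI t (pi (s *: v + w) - (phi s * pi v + pi w))) /\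
    (forall x, inI t (pi (iota x) - x)).

Definition tact (a : {mpoly S[n]}) : R := (map_mpoly phi a).@[t].

(* del j r is the dt_j-component of nabla^0(r) *)
Definition is_connection (del : 'I_n -> R -> R) : Prop :=
  (forall j x y, del j (x + y) = del j x + del j y) /\
  (forall j (a : {mpoly S[n]}) r,
      del j (tact a * r) = tact a * del j r + tact (mderiv j a) * r).

Definition is_flat (del : 'I_n -> R -> R) : Prop :=
  forall i j r, del i (del j r) = del j (del i r).

Definition euler (del : 'I_n -> R -> R) (r : R) : R := \sum_j t j * del j r.

Definition is_standard (del : 'I_n -> R -> R) : Prop :=
  is_flat del /\
  (forall p : nat, (0 < p)%N ->
     let f := fun r => p%:R * r + euler del r in
     bijective f /\
     (forall r, inI t r -> inI t (f r)) /\
     (forall r, inI t r -> exists r', inI t r' /\ f r' = r)) /\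
  (forall r, inI t r <-> exists r', euler del r' = r).
End ConnDefs.

Section LFDefs.
Variables (S : comUnitRingType) (R : comNzRingType) (phi : {rmorphism S -> R}).
Variables (n : nat) (t : 'I_n -> R) (m0 m1 : nat).

(* X = R^m0 (even) (+) R^m1 (odd), elements are column vectors *)
Local Notation V := 'cV[R]_(m0 + m1).

Definition oddmx (B : 'M[R]_(m0, m1)) (C : 'M[R]_(m1, m0)) : 'M[R]_(m0 + m1) :=
  block_mx 0 B C 0.

Definition projmx (b : bool) : 'M[R]_(m0 + m1) :=
  if b then block_mx 0 0 0 1%:M else block_mx 1%:M 0 0 0.

(* X modulo tX (coordinatewise congruence mod tR) or X itself *)
Definition vrel (q : bool) (x y : V) : Prop :=
  if q then forall i, inI t (x i 0 - y i 0) else x = y.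

(* The linear factorisations over S we need: lf_quot = true gives X/tX,
   lf_quot = false gives phi_*(X); lf_shift k applies [k]. *)
Record lfobj := LFObj { lf_quot : bool; lf_shift : nat }.

Variable dX : 'M[R]_(m0 + m1).

Definition lf_d (O : lfobj) : 'M[R]_(m0 + m1) := (-1) ^+ lf_shift O *: dX.
Definition lf_proj (O : lfobj) (b : bool) : 'M[R]_(m0 + m1) :=
  projmx (b (+) odd (lf_shift O)).

Definition is_Smap (O1 O2 : lfobj) (f : V -> V) : Prop :=
  (forall x y, vrel (lf_quot O1) x y -> vrel (lf_quot O2) (f x) (f y)) /\
  (forall (s : S) x y,
     vrel (lf_quot O2) (f (phi s *: x + y)) (phi s *: f x + f y)).

Definition is_parity (c : bool) (O1 O2 : lfobj) (f : V -> V) : Prop :=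
  forall b x, vrel (lf_quot O2) (f (lf_proj O1 b *m x))
                                 (lf_proj O2 (b (+) c) *m f x).

Definition is_lfmor (O1 O2 : lfobj) (f : V -> V) : Prop :=
  [/\ is_Smap O1 O2 f, is_parity false O1 O2 f &
      forall x, vrel (lf_quot O2) (f (lf_d O1 *m x)) (lf_d O2 *m f x)].

Definition homotopic (O1 O2 : lfobj) (f g : V -> V) : Prop :=
  exists h : V -> V, [/\ is_Smap O1 O2 h, is_parity true O1 O2 h &
    forall x, vrel (lf_quot O2) (f x - g x) (lf_d O2 *m h x + h (lf_d O1 *m x))].

Definition comp_ord (F : 'I_n -> V -> V) : V -> V :=
  foldr (fun i g => F i \o g) id (enum 'I_n).

(* components of At(X) = [d_X, nabla_X], nabla_X the coordinatewise
   connection on the basis: At(x) = sum_j atc j x (x) dt_j *)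
Definition atc (del : 'I_n -> R -> R) (j : 'I_n) (x : V) : V :=
  dX *m map_mx (del j) x - map_mx (del j) (dX *m x).

(* At(X)^n, identified with a map X -> X via dt_1 /\ ... /\ dt_n:
   At^n(x) = sum_{j_1..j_n} atc j_1 (... atc j_n x) (x) dt_j1/\.../\dt_jn *)
Definition atn (del : 'I_n -> R -> R) (x : V) : V :=
  \sum_(s : 'S_n) (-1) ^+ s *: comp_ord (fun i => atc del (s i)) x.

Definition e_formula (L : 'I_n -> 'M[R]_(m0 + m1)) (del : 'I_n -> R -> R)
  (x : V) : V :=
  phi ((n`!%:R)^-1 * (-1) ^+ 'C(n.+1, 2)) *:
    comp_ord (fun i => mulmx (L i)) (atn del x).
End LFDefs.

(* Main.v *)
(* Let K = X (x) Lambda(theta_1, ..., theta_n) with the Koszul differential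
   delta = sum_j t_j theta_j^*.  With nabla = sum_j theta_j d/dt_j one has
   delta nabla + nabla delta = p + sum_j t_j d/dt_j in exterior degree p, which
   the standard connection makes invertible for p > 0; this contracts K onto
   X/tX over S.  The homological perturbation lemma, applied to d_X, turns the
   contraction into a homotopy equivalence of X/tX with (K, d_X + delta).
   On the other side theta_j - lambda_j anticommutes with d_X + delta, so
   y |-> prod_j (theta_j - lambda_j) y embeds X[n] into K, strictly split by
   the projection to the top exterior degree.  Composing gives psi and
   vartheta = (-1)^n lambda_1 ... lambda_n.  The inverse of
   p + sum_j t_j d/dt_j is 1/p modulo t, which is the source of 1/n!, and
   reordering the theta_j past the odd Atiyah components contributes the
   remaining sign (-1)^(n choose 2). *)

Require Import Defs.
From HB Require Import structures.
From mathcomp Require Import all_boot all_order all_algebra all_fingroup.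
From mathcomp Require Import mpoly.
Import GRing.Theory.
Local Open Scope ring_scope.

(** * Maps between R-modules that are linear over S *)

(** The modules stay over R, with S acting through [phi]: connections are linear over S only, yet
    they have to be compared with multiplication by t_j. *)
Definition slin {S : comUnitRingType} {R : comNzRingType}
    (phi : {rmorphism S -> R}) {U V : lmodType R} (f : U -> V) :=
  forall s x y, f (phi s *: x + y) = phi s *: f x + f y.

Section SLinear.
Context {S : comUnitRingType} {R : comNzRingType} {phi : {rmorphism S -> R}}.
Local Notation slin := (slin phi).

Section Basic.
Context {U V : lmodType R} {f : U -> V}.
Hypothesis fS : slin f.

Lemma slinD x y : f (x + y) = f x + f y.
Proof. by have := fS 1 x y; rewrite rmorph1 !scale1r. Qed.

Lemma slin0 : f 0 = 0.
Proof. by apply: (addrI (f 0)); rewrite -slinD !addr0. Qed.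

Lemma slinZ s x : f (phi s *: x) = phi s *: f x.
Proof. by have := fS s x 0; rewrite slin0 !addr0. Qed.

Lemma slinN x : f (- x) = - f x.
Proof. by have := slinZ (- 1) x; rewrite rmorphN1 !scaleN1r. Qed.

Lemma slinB x y : f (x - y) = f x - f y.
Proof. by rewrite slinD slinN. Qed.

Lemma slin_sum (I : Type) (r : seq I) (P : pred I) (F : I -> U) :
  f (\sum_(i <- r | P i) F i) = \sum_(i <- r | P i) f (F i).
Proof. exact: (big_morph f slinD slin0). Qed.

Lemma slin_sign k x : f ((-1) ^+ k *: x) = (-1) ^+ k *: f x.
Proof. by have := slinZ ((-1) ^+ k) x; rewrite rmorphXn rmorphN1. Qed.

Lemma slin_nat k x : f (k%:R *: x) = k%:R *: f x.
Proof. by have := slinZ k%:R x; rewrite rmorph_nat. Qed.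

End Basic.

Lemma slin_id {V : lmodType R} : slin (@id V).
Proof. by []. Qed.

Lemma slin_comp {U V W : lmodType R} (g : V -> W) (f : U -> V) :
  slin g -> slin f -> slin (fun x => g (f x)).
Proof. by move=> gS fS s x y; rewrite fS gS. Qed.

Lemma slin_add {U V : lmodType R} (f g : U -> V) :
  slin f -> slin g -> slin (fun x => f x + g x).
Proof. by move=> fS gS s x y; rewrite fS gS scalerDr addrACA. Qed.

Lemma slin_scale {U V : lmodType R} (c : R) (f : U -> V) :
  slin f -> slin (fun x => c *: f x).
Proof. by move=> fS s x y; rewrite fS scalerDr !scalerA mulrC. Qed.

Lemma slin_opp {U V : lmodType R} (f : U -> V) :
  slin f -> slin (fun x => - f x).
Proof. by move=> fS s x y; rewrite fS opprD scalerN. Qed.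

Lemma slin_bigsum {U V : lmodType R} (I : Type) (r : seq I) (f : I -> U -> V) :
  (forall i, slin (f i)) -> slin (fun x => \sum_(i <- r) f i x).
Proof.
move=> fS s x y; rewrite scaler_sumr -big_split; apply: eq_bigr => i _.
exact: fS.
Qed.

Lemma slin_iter {V : lmodType R} (f : V -> V) k : slin f -> slin (iter k f).
Proof. by move=> fS; elim: k => [|k IH] s x y //=; rewrite IH fS. Qed.

Lemma slin_foldr {V : lmodType R} (I : Type) (r : seq I) (f : I -> V -> V) :
  (forall i, slin (f i)) -> slin (fun x => foldr f x r).
Proof. by move=> fS; elim: r => [|i r IH] s x y //=; rewrite IH fS. Qed.

Lemma slin_inv {V : lmodType R} (f g : V -> V) :
  slin f -> cancel f g -> cancel g f -> slin g.
Proof.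
by move=> fS fK gK s x y; rewrite -[in LHS](gK x) -[in LHS](gK y) -fS fK.
Qed.

(** This is how antisymmetry gets used: a double sum of anticommuting terms, or a word with a
    repeated letter, equals its own negative. *)
Lemma eqN_eq0 {V : lmodType R} (x : V) :
  (2%:R : S) \is a GRing.unit -> x = - x -> x = 0.
Proof.
move=> S2 xN; have xx : 2%:R *: x = 0 by rewrite scaler_nat mulr2n {2}xN subrr.
have : phi (2%:R^-1 * 2%:R) *: x = 0.
  by rewrite rmorphM [phi 2%:R]rmorph_nat -scalerA xx scaler0.
by rewrite mulVr // rmorph1 scale1r.
Qed.

End SLinear.

(** * Homological perturbation *)

Section Perturbation.
Context {S : comUnitRingType} {R : comNzRingType} (phi : {rmorphism S -> R}).
Variables (A : lmodType R) (W : S) (d b H T : A -> A).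
Hypotheses (dS : slin phi d) (bS : slin phi b) (HS : slin phi H) (TS : slin phi T).
Hypothesis dd : forall x, d (d x) = phi W *: x.
Hypothesis bb : forall x, b (b x) = 0.
Hypothesis db : forall x, d (b x) = - b (d x).
Hypothesis HH : forall x, H (H x) = 0.
Hypothesis TK : forall x, T (x + H (d x)) = x.
Hypothesis KT : forall x, T x + H (d (T x)) = x.

(** The failure of H to contract b. In the Koszul case it kills positive exterior degree and all
    multiples of the t_j. *)
Definition residue x := x - b (H x) - H (b x).

Hypothesis residueTH : forall x, residue (d (T (H x))) = 0.

(* With U = 1 + H d = T^-1 one has U (d + b) = b U + W H + residue d, and
   H T H = 0, so U (d + b) T H = b H. *)
Lemma perturbation x :
  T (residue x) = x - (d (T (H x)) + b (T (H x))) - T (H (d x + b x)).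
Proof.
set D := fun y => d y + b y.
have HTH : H (T (H x)) = 0.
  have : H (T (H x) + H (d (T (H x)))) = 0 by rewrite KT HH.
  by rewrite (slinD HS) HH addr0.
have UDTH : D (T (H x)) + H (d (D (T (H x)))) = b (H x).
  rewrite /D (slinD dS) dd db (slinD HS) (slinZ HS) HTH scaler0 add0r (slinN HS).
  have := residueTH x; rewrite /residue => /eqP; rewrite subr_eq add0r => /eqP <-.
  by rewrite opprB [d _ + _]addrC addrACA subrr addr0 -(slinD bS) KT.
have -> : x - (d (T (H x)) + b (T (H x))) - T (H (d x + b x)) =
    T (x + H (d x) - b (H x) - H (d x + b x)).
  by rewrite !(slinB TS) TK -UDTH TK.
congr T; rewrite /residue (slinD HS) opprD addrA; congr (_ - _).
by rewrite [x + _ - _]addrAC addrK.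
Qed.

(** With D = d + b, [perturbation] writes T residue as 1 - (D T H + T H D). This commutes with D
    because D D = W is a scalar from S. *)
Lemma perturbation_comm x :
  d (T (residue x)) + b (T (residue x)) = T (residue (d x + b x)).
Proof.
set D := fun y => d y + b y.
have DS : slin phi D by exact: slin_add.
have DD y : D (D y) = phi W *: y.
  by rewrite /D (slinD dS) (slinD bS) dd bb db addr0 addrNK.
rewrite -[LHS]/(D _) -[d x + b x]/(D x) !perturbation -!/(D _) !(slinB DS).
by rewrite !DD (slinZ HS) (slinZ TS) addrAC.
Qed.

End Perturbation.

(** * Signs of exterior monomials *)

(** The exponent of the sign that brings theta_j to its place in the increasing monomial theta_I. *)
Definition below {n} (j : 'I_n) (I : {set 'I_n}) := #|[set i in I | (i < j)%N]|.

Section Below.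
Context {n : nat}.
Implicit Types (i j : 'I_n) (I : {set 'I_n}).

Lemma belowU i j I : i \notin I -> below j (i |: I) = ((i < j) + below j I)%N.
Proof.
move=> iI; rewrite /below; case: (boolP (i < j)%N) => ij.
  rewrite -(_ : i |: [set k in I | (k < j)%N] = [set k in i |: I | (k < j)%N]).
    by rewrite cardsU1 !inE (negbTE iI).
  by apply/setP=> k; rewrite !inE; case: eqVneq => //= ->.
rewrite add0n; apply: eq_card => k; rewrite !inE.
by case: eqVneq => //= ->; rewrite (negbTE ij) andbF.
Qed.

Lemma belowD i j I : i \in I -> below j I = ((i < j) + below j (I :\ i))%N.
Proof. by move=> iI; rewrite -belowU ?setD1K // !inE eqxx. Qed.

Lemma below_min j I : (forall i, i \in I -> (j <= i)%N) -> below j I = 0%N.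
Proof.
move=> jI; apply/eqP; rewrite cards_eq0; apply/eqP/setP=> i; rewrite !inE.
by apply/negP=> /andP[/jI]; rewrite leqNgt => /negP.
Qed.

End Below.

(** * The exterior algebra *)

Section Clifford.
Context {S : comUnitRingType} {R : comNzRingType} {phi : {rmorphism S -> R}}.
Context {n : nat} {V : lmodType R}.
Local Notation slin := (slin phi).
Local Notation A := {ffun {set 'I_n} -> V}.
Implicit Types (a : A) (i j : 'I_n) (I : {set 'I_n}) (f : V -> V).

Lemma fcoefD a b I : (a + b) I = a I + b I. Proof. by rewrite ffunE. Qed.

Lemma fcoefN a I : (- a) I = - a I. Proof. by rewrite ffunE. Qed.

Lemma fcoefB a b I : (a - b) I = a I - b I.
Proof. by rewrite fcoefD fcoefN. Qed.

(** Left multiplication by theta_j and, after it, contraction with the dual of theta_j, both in the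
    basis of increasing monomials. *)
Definition th j a : A :=
  [ffun I : {set 'I_n} => if j \in I then (-1) ^+ below j I *: a (I :\ j) else 0].
Definition ts j a : A :=
  [ffun I : {set 'I_n} => if j \in I then 0 else (-1) ^+ below j I *: a (j |: I)].
(* A family a indexed by subsets I stands for sum_I theta_I a_I, the theta's on
   the left: an odd operator f on V acts through the signed extension [ext f],
   an even one through [extu f]. *)
Definition extu f a : A := [ffun I => f (a I)].
Definition ext f a : A := [ffun I : {set 'I_n} => (-1) ^+ #|I| *: f (a I)].
Definition inc0 (v : V) : A := [ffun I => if I == set0 then v else 0].

(** Exactly one of i < j and j < i holds, so treating i and j in the other order costs one sign. All
    anticommutation rules below reduce to this or to its mixed variant [sign_swap2]. *)
Lemma sign_swap i j (b c : nat) : i != j ->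
  (-1) ^+ ((j < i) + c) * (-1) ^+ b = - ((-1) ^+ ((i < j) + b) * (-1) ^+ c) :> R.
Proof.
rewrite -!exprD -val_eqE /= neq_ltn => /orP[] ij;
  by rewrite ij ltnNge (ltnW ij) /= addSn exprS mulN1r ?opprK add0n addnC.
Qed.

Lemma sign_swap2 i j (b c : nat) : i != j ->
  (-1) ^+ ((j < i) + c) * (-1) ^+ ((i < j) + b) = - ((-1) ^+ b * (-1) ^+ c) :> R.
Proof.
rewrite -!exprD -val_eqE /= neq_ltn => /orP[] ij;
  by rewrite ij ltnNge (ltnW ij) /= add0n ?addnS ?addSn exprS mulN1r addnC. Qed.

Lemma sign_sqr (b : nat) : (-1) ^+ b * (-1) ^+ b = 1 :> R.
Proof. by rewrite -expr2 sqrr_sign. Qed.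

Lemma th_th i j a : th i (th j a) = - th j (th i a).
Proof.
apply/ffunP=> I; rewrite !ffunE !inE.
have [->|ij] := eqVneq i j.
  by rewrite /= scaler0 !if_same oppr0.
rewrite /=.
have [iI|iI] := boolP (i \in I); have [jI|jI] := boolP (j \in I);
  rewrite ?scaler0 ?oppr0 //.
rewrite !scalerA (belowD j i I jI) (belowD i j I iI) -scaleNr.
by rewrite setDDl setUC -setDDl sign_swap.
Qed.

Lemma ts_ts i j a : ts i (ts j a) = - ts j (ts i a).
Proof.
apply/ffunP=> I; rewrite !ffunE !inE.
have [->|ij] := eqVneq i j.
  by rewrite /= scaler0 !if_same oppr0.
rewrite /=.
have [iI|iI] := boolP (i \in I); have [jI|jI] := boolP (j \in I);
  rewrite ?scaler0 ?oppr0 //.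
rewrite !scalerA (belowU j i I jI) (belowU i j I iI) -scaleNr setUCA.
by rewrite mulrC [in RHS]mulrC (sign_swap j i) 1?eq_sym.
Qed.

(** For i = j exactly one of the two terms survives, depending on whether j lies in I, and its sign
    appears squared. Together with [th_th] and [ts_ts] these are the Clifford relations. *)
Lemma ts_th i j a : ts i (th j a) + th j (ts i a) = if i == j then a else 0.
Proof.
apply/ffunP=> I; rewrite !ffunE !inE.
have [->|ij] := eqVneq i j.
  rewrite /=.
  have [jI|jI] := boolP (j \in I).
    by rewrite scalerA setD1K // (belowD j j I jI) ltnn sign_sqr scale1r add0r.
  by rewrite addr0 scalerA setU1K // belowU // ltnn sign_sqr scale1r.
rewrite /= ffunE.
have [iI|iI] := boolP (i \in I); have [jI|jI] := boolP (j \in I);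
  rewrite ?scaler0 ?addr0 //.
rewrite !scalerA (belowU i j I iI) (belowD j i I jI) sign_swap2 //.
rewrite setDUl (_ : [set i] :\ j = [set i]) ?scaleNr; last first.
  by apply/setP=> k; rewrite !inE; case: (eqVneq k i) => [->|]; rewrite ?ij ?andbF.
by rewrite addrC addrN.
Qed.

Lemma th_slin j : slin (th j).
Proof.
move=> s x y; apply/ffunP=> I; rewrite !ffunE.
by case: ifP; rewrite ?scaler0 ?addr0 // scalerDr !scalerA mulrC.
Qed.

Lemma ts_slin j : slin (ts j).
Proof.
move=> s x y; apply/ffunP=> I; rewrite !ffunE.
by case: ifP; rewrite ?scaler0 ?addr0 // scalerDr !scalerA mulrC.
Qed.

Lemma thZ j r a : th j (r *: a) = r *: th j a.
Proof.
by apply/ffunP=> I; rewrite !ffunE; case: ifP; rewrite ?scaler0 // !scalerA mulrC.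
Qed.

Lemma tsZ j r a : ts j (r *: a) = r *: ts j a.
Proof.
by apply/ffunP=> I; rewrite !ffunE; case: ifP; rewrite ?scaler0 // !scalerA mulrC.
Qed.

Lemma inc0_slin : slin inc0.
Proof.
by move=> s x y; apply/ffunP=> I; rewrite !ffunE; case: ifP; rewrite ?scaler0 ?addr0.
Qed.

Lemma coef_slin I : slin (fun a => a I).
Proof. by move=> s x y; rewrite !ffunE. Qed.

Lemma ts_inc0 j v : ts j (inc0 v) = 0.
Proof.
apply/ffunP=> I; rewrite !ffunE; case: ifP => // _.
have /negbTE -> : j |: I != set0 by apply/set0Pn; exists j; rewrite !inE eqxx.
by rewrite scaler0.
Qed.

Lemma th_coef0 j a : th j a set0 = 0.
Proof. by rewrite ffunE inE. Qed.

Section Extension.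
Context {f : V -> V}.
Hypothesis fS : slin f.

Lemma extu_slin : slin (extu f).
Proof. by move=> s x y; apply/ffunP=> I; rewrite !ffunE fS. Qed.

Lemma ext_slin : slin (ext f).
Proof.
by move=> s x y; apply/ffunP=> I; rewrite !ffunE fS scalerDr !scalerA mulrC.
Qed.

Lemma extu_th j a : extu f (th j a) = th j (extu f a).
Proof.
by apply/ffunP=> I; rewrite !ffunE; case: ifP => _;
  rewrite ?(slin_sign fS) ?(slin0 fS) // ffunE.
Qed.

Lemma extu_ts j a : extu f (ts j a) = ts j (extu f a).
Proof.
by apply/ffunP=> I; rewrite !ffunE; case: ifP => _;
  rewrite ?(slin_sign fS) ?(slin0 fS) // ffunE.
Qed.

Lemma ext_th j a : ext f (th j a) = - th j (ext f a).
Proof.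
apply/ffunP=> I; rewrite !ffunE; case: ifP => [jI|_]; last first.
  by rewrite (slin0 fS) scaler0 oppr0.
rewrite (slin_sign fS) (cardsD1 j) jI !scalerA -scaleNr; congr (_ *: _).
by rewrite mulrC exprS mulN1r mulrN.
Qed.

Lemma ext_ts j a : ext f (ts j a) = - ts j (ext f a).
Proof.
apply/ffunP=> I; rewrite !ffunE; case: ifP => [_|jI].
  by rewrite (slin0 fS) scaler0 oppr0.
rewrite (slin_sign fS) cardsU1 jI !scalerA -scaleNr; congr (_ *: _).
by rewrite mulrC exprS mulN1r mulrN opprK.
Qed.

Lemma ext_inc0 v : ext f (inc0 v) = inc0 (f v).
Proof.
apply/ffunP=> I; rewrite !ffunE; case: eqP => [->|_].
  by rewrite cards0 scale1r.
by rewrite (slin0 fS) scaler0.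
Qed.

End Extension.

Lemma extu_ext f g a : slin f -> extu f (ext g a) = ext (fun v => f (g v)) a.
Proof. by move=> fS; apply/ffunP=> I; rewrite !ffunE (slin_sign fS). Qed.

Lemma ext_extu f g a : ext f (extu g a) = ext (fun v => f (g v)) a.
Proof. by apply/ffunP=> I; rewrite !ffunE. Qed.

Lemma ext_ext f g a : slin f -> ext f (ext g a) = extu (fun v => f (g v)) a.
Proof.
move=> fS; apply/ffunP=> I; rewrite !ffunE (slin_sign fS) scalerA sign_sqr.
by rewrite scale1r.
Qed.

(** The filtration [degge] serves to prove nilpotence, the grading [pure] to single out one term of
    a series. *)
Definition degge k a := forall I, (#|I| < k)%N -> a I = 0.
Definition pure k a := forall I, #|I| != k -> a I = 0.

Lemma degge_eq0 a : degge n.+1 a -> a = 0.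
Proof.
move=> aF; apply/ffunP=> I; rewrite ffunE aF //.
by rewrite ltnS -[leqRHS]card_ord max_card.
Qed.

Lemma degge_sum k (r : seq 'I_n) (F : 'I_n -> A) :
  (forall j, degge k (F j)) -> degge k (\sum_(j <- r) F j).
Proof. by move=> FF I Ik; rewrite sum_ffunE big1 // => j _; apply: FF. Qed.

Lemma pure_sum k (r : seq 'I_n) (F : 'I_n -> A) :
  (forall j, pure k (F j)) -> pure k (\sum_(j <- r) F j).
Proof. by move=> FF I Ik; rewrite sum_ffunE big1 // => j _; apply: FF. Qed.

Lemma th_degge k j a : degge k a -> degge k.+1 (th j a).
Proof.
move=> aF I; rewrite ffunE; case: ifP => // jI.
by rewrite (cardsD1 j) jI ltnS => /aF ->; rewrite scaler0.
Qed.

Lemma th_pure k j a : pure k a -> pure k.+1 (th j a).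
Proof.
move=> aF I; rewrite ffunE; case: ifP => // jI.
by rewrite (cardsD1 j) jI eqSS => /aF ->; rewrite scaler0.
Qed.

Lemma ts_pure k j a : pure k.+1 a -> pure k (ts j a).
Proof.
move=> aF I Ik; rewrite ffunE; case: ifP => // jI.
by rewrite aF ?scaler0 // cardsU1 jI eqSS.
Qed.

Lemma inc0_pure v : pure 0 (inc0 v).
Proof. by move=> I; rewrite ffunE cards_eq0 => /negbTE ->. Qed.

End Clifford.

(** * Products of the theta_j along a word *)

Section Words.
Context {S : comUnitRingType} {R : comNzRingType} {phi : {rmorphism S -> R}}.
Context {n : nat} {V : lmodType R}.
Local Notation slin := (slin phi).
Local Notation A := {ffun {set 'I_n} -> V}.
Implicit Types (a : A) (i j : 'I_n) (w : seq 'I_n).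

Lemma foldr_th_move i w a :
  foldr th (th i a) w = (-1) ^+ size w *: th i (foldr th a w).
Proof.
elim: w => [|j w IH] /=; first by rewrite scale1r.
by rewrite IH thZ th_th exprS -scalerA scaleN1r scalerN.
Qed.

Lemma foldr_th_swap i j w1 w2 a :
  foldr th a (i :: w1 ++ j :: w2) = - foldr th a (j :: w1 ++ i :: w2).
Proof. by rewrite /= !foldr_cat /= !foldr_th_move !thZ th_th scalerN. Qed.

(** If the head of the word is x or y, it is exchanged with the other one by anticommutation; any
    other head is fixed and induction applies. The map [f] is arbitrary so that both permutations
    and noninjective maps are covered. *)
Lemma foldr_th_tperm (T : finType) (f : T -> 'I_n) (x y : T) (w : seq T) a :
  x != y -> x \in w -> y \in w -> uniq w ->
  foldr th a [seq f (tperm x y z) | z <- w] = - foldr th a [seq f z | z <- w].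
Proof.
have fix_map (u v : T) (w' : seq T) : u \notin w' -> v \notin w' ->
    [seq f (tperm u v z) | z <- w'] = [seq f z | z <- w'].
  move=> uw' vw'; apply/eq_in_map => z zw'.
  rewrite tpermD //; [apply: contraNneq uw' | apply: contraNneq vw'];
  by move=> ->.
have head_swap (u v : T) (w' : seq T) : v \in w' -> uniq (u :: w') ->
    foldr th a [seq f (tperm u v z) | z <- u :: w'] =
    - foldr th a [seq f z | z <- u :: w'].
  case/splitPr=> w1 w2; rewrite cons_uniq mem_cat inE cat_uniq /= !negb_or.
  case/andP=> /and3P[uw1 _ uw2] /and4P[_ /andP[vw1 _] vw2 _].
  rewrite !map_cat /= tpermL tpermR !fix_map //.
  exact: foldr_th_swap.
move=> xy; elim: w => //= z w IH; rewrite !inE => xw yw /andP[zw uw].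
have [zx|zx] := eqVneq z x.
  move: yw; rewrite zx eq_sym (negbTE xy) /= => yw.
  by apply: (head_swap x y) => //=; rewrite -zx zw.
have [zy|zy] := eqVneq z y.
  move: xw; rewrite zy (negbTE xy) /= => xw; rewrite tpermC.
  by apply: (head_swap y x) => //=; rewrite -zy zw.
move: xw yw; rewrite !(eq_sym _ z) (negbTE zx) (negbTE zy) /= => xw yw.
rewrite IH // tpermD 1?eq_sym //.
by rewrite -[X in _ = - X]/(th _ _) -scaleN1r thZ scaleN1r.
Qed.

(** Each factor in a decomposition of s into transpositions contributes one sign. *)
Lemma foldr_th_perm (s : 'S_n) (w : seq 'I_n) a : (forall i, i \in w) -> uniq w ->
  foldr th a [seq s i | i <- w] = (-1) ^+ s *: foldr th a w.
Proof.
move=> wT uw; have [ts -> dts] := prod_tpermP s.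
rewrite odd_perm_prod // signr_odd; move: dts.
elim: ts => [_|[x y] ts IH /andP[xy /IH {}IH]] /=.
  rewrite big_nil expr0 scale1r; congr foldr.
  by rewrite -[RHS]map_id; apply: eq_map => i; rewrite perm1.
rewrite big_cons exprS -scalerA -IH scaleN1r.
rewrite -(foldr_th_tperm _ (fun z => (\prod_(t <- ts) tperm t.1 t.2)%g z) x y w) //.
by congr foldr; apply: eq_map => i; rewrite permM.
Qed.

(** Transposing two indices with the same value leaves the word as it is but changes the sign. *)
Lemma foldr_th_noninj (f : 'I_n -> 'I_n) (w : seq 'I_n) a :
  (2%:R : S) \is a GRing.unit -> (forall i, i \in w) -> uniq w ->
  ~~ injectiveb f -> foldr th a [seq f i | i <- w] = 0.
Proof.
move=> S2 wT uw /injectivePn[x [y xy fxy]].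
apply: (eqN_eq0 (phi := phi) _ S2); rewrite -(foldr_th_tperm _ f x y w) //.
by congr foldr; apply: eq_map => z; case: tpermP => // ->.
Qed.

Section ThetaLambdaProducts.
Variable lam : 'I_n -> V -> V.
Hypothesis lamS : forall j, slin (lam j).

Definition thlam j a : A := th j a - ext (lam j) a.

Lemma thlamE j a I : thlam j a I = th j a I - ext (lam j) a I.
Proof. exact: fcoefB. Qed.

(** Every theta raises the degree, so only the product of the terms - lambda_j reaches degree
    zero. *)
Lemma thlam_coef0 w v :
  foldr thlam (inc0 v) w set0 = (-1) ^+ size w *: foldr lam v w.
Proof.
elim: w => [|j w IH] /=; first by rewrite ffunE eqxx scale1r.
rewrite thlamE th_coef0 add0r ffunE cards0 scale1r IH (slin_sign (lamS j)).
by rewrite exprS -scalerA scaleN1r.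
Qed.

(** Only letters of the word can occur in a monomial, and the full monomial takes theta from every
    factor. Its sign is trivial because each new letter is smaller than all those already
    present. *)
Lemma thlam_coef w v : sorted ltn [seq val i | i <- w] ->
  foldr thlam (inc0 v) w [set i in w] = v /\
  (forall I : {set 'I_n}, ~~ (I \subset [set i in w]) -> foldr thlam (inc0 v) w I = 0).
Proof.
elim: w => [|j w IH] /= jw.
  split=> [|I].
    by rewrite ffunE; case: eqP => // [[]]; apply/setP=> i; rewrite !inE.
  by rewrite ffunE; case: eqP => // ->; rewrite sub0set.
have [IHw IHs] := IH (path_sorted jw).
have jmin i : i \in w -> (j < i)%N.
  move=> iw; have /allP := order_path_min ltn_trans jw; apply.
  exact: map_f.
have jw' : j \notin w by apply/negP => /jmin; rewrite ltnn.
have Ew : [set i in j :: w] = j |: [set i in w] by apply/setP=> i; rewrite !inE.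
rewrite Ew; split=> [|I Iw]; rewrite thlamE [th _ _ _]ffunE.
  rewrite setU11 below_min; last first.
    by move=> i; rewrite !inE => /orP[/eqP->|/jmin/ltnW].
  rewrite expr0 scale1r setU1K ?inE // IHw ffunE IHs ?(slin0 (lamS j)).
    by rewrite scaler0 oppr0 addr0.
  by apply/subsetPn; exists j; rewrite ?setU11 // inE.
have IHI : foldr thlam (inc0 v) w I = 0.
  by apply: IHs; apply: contraNN Iw => /subset_trans; apply; apply: subsetU1.
rewrite [ext _ _ _]ffunE IHI (slin0 (lamS j)) scaler0 oppr0 addr0.
case: ifP => // jI; rewrite IHs ?scaler0 //.
by apply: contraNN Iw; rewrite subDset.
Qed.

End ThetaLambdaProducts.

End Words.

(** * Powers of the Atiyah operator *)

Section Iterate.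
Context {S : comUnitRingType} {R : comNzRingType} {phi : {rmorphism S -> R}}.
Context {n : nat} {V : lmodType R}.
Local Notation slin := (slin phi).
Local Notation A := {ffun {set 'I_n} -> V}.
Implicit Types (a : A) (i j : 'I_n) (w : seq 'I_n).

Lemma sorted_enum_ord : sorted ltn [seq val i | i <- enum 'I_n].
Proof. by rewrite val_enum_ord iota_ltn_sorted. Qed.

Lemma set_enum_ord : [set i in enum 'I_n] = [set: 'I_n].
Proof. by apply/setP=> i; rewrite !inE mem_enum. Qed.

Lemma top_foldr_th (v : V) : foldr th (inc0 v) (enum 'I_n) [set: 'I_n] = v.
Proof.
(* The coefficient is read off from [thlam_coef] with every lambda_j equal to zero. *)
have zS (j : 'I_n) : slin (fun _ : V => 0 : V).
  by move=> s x y; rewrite scaler0 addr0.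
have := (thlam_coef _ zS (enum 'I_n) v sorted_enum_ord).1; rewrite set_enum_ord.
suff -> : foldr (thlam (fun=> fun=> 0)) (inc0 v) (enum 'I_n)
  = foldr th (inc0 v) (enum 'I_n) by [].
elim: (enum _) => //= j w ->; apply/ffunP=> I.
by rewrite thlamE [ext _ _ _]ffunE scaler0 subr0.
Qed.

Lemma ext_foldr_th (f : V -> V) w a : slin f ->
  ext f (foldr th a w) = (-1) ^+ size w *: foldr th (ext f a) w.
Proof.
move=> fS; elim: w => [|j w IH] /=; first by rewrite scale1r.
by rewrite (ext_th fS) IH thZ exprS -scalerA scaleN1r.
Qed.

Variable at_ : 'I_n -> V -> V.
Hypothesis atS : forall j, slin (at_ j).

(** The Atiyah class as a single operator on the exterior algebra, theta_j standing for dt_j. *)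
Definition atiyah a := \sum_j th j (ext (at_ j) a).

(** Moving one more odd component past k thetas costs (-1)^k, and these exponents add up to
    C(k,2). *)
Lemma iter_atiyah k (v : V) : iter k atiyah (inc0 v) =
  (-1) ^+ 'C(k, 2) *: \sum_(w : k.-tuple 'I_n) foldr th (inc0 (foldr at_ v w)) w.
Proof.
elim: k => [|k IH] /=.
  rewrite expr0 scale1r (big_pred1 [tuple]) // => w.
  by apply/esym/eqP; apply: tuple0.
rewrite IH /atiyah binS bin1 exprD -scalerA.
transitivity (\sum_j \sum_(w : k.-tuple 'I_n) (-1) ^+ 'C(k, 2) *: ((-1) ^+ k *:
    foldr th (inc0 (foldr at_ v (j :: w))) (j :: w))).
  apply: eq_bigr => j _.
  rewrite (slin_sign (ext_slin (atS j))) thZ (slin_sum (ext_slin (atS j))).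
  rewrite (slin_sum (th_slin j (phi := phi))) scaler_sumr; apply: eq_bigr => w _.
  by rewrite ext_foldr_th // thZ (ext_inc0 (atS j)) size_tuple.
rewrite pair_big /= -!scaler_sumr; do 2!congr (_ *: _).
rewrite [RHS](reindex (fun p : 'I_n * k.-tuple 'I_n => [tuple of p.1 :: p.2])) //=.
exists (fun w : k.+1.-tuple 'I_n => (thead w, [tuple of behead w])) => [[j w] _|w _] /=.
  by congr (_, _); apply: val_inj.
by rewrite -tuple_eta.
Qed.

Lemma top_iter_atiyah (v : V) : (2%:R : S) \is a GRing.unit ->
  iter n atiyah (inc0 v) [set: 'I_n] = (-1) ^+ 'C(n, 2) *:
    \sum_(s : 'S_n) (-1) ^+ s *: foldr at_ v [seq s i | i <- enum 'I_n].
Proof.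
move=> S2; rewrite iter_atiyah ffunE sum_ffunE; congr (_ *: _).
(* Words of length n are functions on ['I_n]. The noninjective ones contribute zero, and the
   injective ones are permutations, which sort to the full monomial with their sign. *)
rewrite (reindex (fun f : {ffun 'I_n -> 'I_n} => mktuple f)) /=; last first.
  exists (fun w : n.-tuple 'I_n => [ffun i => tnth w i]) => [f _|w _].
    by apply/ffunP=> i; rewrite ffunE tnth_mktuple.
  by apply: eq_from_tnth => i; rewrite tnth_mktuple ffunE.
rewrite (bigID (fun f : {ffun 'I_n -> 'I_n} => injectiveb f)) /= addrC big1 ?add0r.
  rewrite (reindex (@pval _)) /=; last first.
    pose in_Sn := insubd (1%g : 'S_n).
    by exists in_Sn => /= f Uf; first apply: val_inj; apply: insubdK.
  apply: eq_big => /= [s|s _]; first by rewrite ?(valP s).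
  have -> : [seq pval s i | i <- enum 'I_n] = [seq s i | i <- enum 'I_n].
    by apply: eq_map => i; rewrite pvalE.
  rewrite foldr_th_perm ?enum_uniq //; last by move=> i; rewrite mem_enum.
  by rewrite ffunE top_foldr_th.
move=> f nf; rewrite (foldr_th_noninj (phi := phi)) ?enum_uniq ?ffunE //.
by move=> i; rewrite mem_enum.
Qed.

End Iterate.

(** * The Koszul complex and its contraction *)

Section KoszulContraction.
Context {S : comUnitRingType} {R : comNzRingType} {phi : {rmorphism S -> R}}.
Context {n : nat} {V : lmodType R}.
Local Notation slin := (slin phi).
Local Notation A := {ffun {set 'I_n} -> V}.
Implicit Types (a : A) (i j : 'I_n) (I : {set 'I_n}) (v : V).
Variables (t : 'I_n -> R) (D : 'I_n -> V -> V) (g : nat -> V -> V).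

Definition koszul a : A := \sum_j t j *: ts j a.
Definition nabla a : A := \sum_j th j (extu (D j) a).
Definition eulerV v := \sum_j t j *: D j v.
(** The inverse of the Laplacian of [koszul] and [nabla] in positive degree. It is zero in degree
    zero, where no inverse is supplied. *)
Definition green a : A := [ffun I : {set 'I_n} => if I == set0 then 0 else g #|I| (a I)].
Definition contraction a := green (nabla a).

Hypothesis S2 : (2%:R : S) \is a GRing.unit.
Hypothesis DS : forall j, slin (D j).
Hypothesis Dt : forall i j v,
  D j (t i *: v) = t i *: D j v + (if i == j then v else 0).
Hypothesis Dflat : forall i j v, D i (D j v) = D j (D i v).
Hypothesis gE : forall p v, (0 < p)%N -> p%:R *: g p v + eulerV (g p v) = v.
Hypothesis Eg : forall p v, (0 < p)%N -> g p (p%:R *: v + eulerV v) = v.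

Lemma eulerV_slin : slin eulerV.
Proof. by apply: slin_bigsum => j; apply: slin_scale. Qed.

Lemma green_arg_slin p : slin (fun v => p%:R *: v + eulerV v).
Proof.
by apply: slin_add; [exact: (slin_scale _ _ slin_id) | exact: eulerV_slin].
Qed.

Lemma g_slin p : (0 < p)%N -> slin (g p).
Proof.
move=> p0; apply: (slin_inv _ _ (green_arg_slin p)) => v; first exact: Eg.
exact: gE.
Qed.

Lemma koszul_slin : slin koszul.
Proof. by apply: slin_bigsum => j; apply: slin_scale; apply: ts_slin. Qed.

Lemma nabla_slin : slin nabla.
Proof.
apply: slin_bigsum => j.
by apply: slin_comp; [exact: th_slin | exact: extu_slin (DS j)].
Qed.

Lemma green_slin : slin green.
Proof.
move=> s x y; apply/ffunP=> I; rewrite !ffunE; case: eqP => [_|/eqP I0].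
  by rewrite scaler0 addr0.
by rewrite g_slin // card_gt0.
Qed.

Lemma contraction_slin : slin contraction.
Proof. exact: slin_comp green_slin nabla_slin. Qed.

Lemma koszul_koszul a : koszul (koszul a) = 0.
Proof.
apply: (eqN_eq0 (phi := phi) _ S2); rewrite /koszul.
have E : \sum_i t i *: ts i (\sum_j t j *: ts j a) =
    \sum_i \sum_j (t i * t j) *: ts i (ts j a).
  apply: eq_bigr => i _; rewrite (slin_sum (ts_slin i (phi := phi))) scaler_sumr.
  by apply: eq_bigr => j _; rewrite tsZ scalerA.
rewrite E [in RHS]exchange_big -sumrN; apply: eq_bigr => i _ /=.
rewrite -sumrN; apply: eq_bigr => j _.
by rewrite mulrC ts_ts scalerN.
Qed.

Lemma nabla_nabla a : nabla (nabla a) = 0.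
Proof.
apply: (eqN_eq0 (phi := phi) _ S2); rewrite /nabla.
have E : \sum_i th i (extu (D i) (\sum_j th j (extu (D j) a))) =
    \sum_i \sum_j th i (th j (extu (D i) (extu (D j) a))).
  apply: eq_bigr => i _; rewrite (slin_sum (extu_slin (DS i))).
  rewrite (slin_sum (th_slin i (phi := phi))).
  by apply: eq_bigr => j _; rewrite (extu_th (DS i)).
rewrite E [in RHS]exchange_big -sumrN; apply: eq_bigr => i _ /=.
rewrite -sumrN; apply: eq_bigr => j _.
rewrite th_th; congr (- th _ (th _ _)).
by apply/ffunP=> I; rewrite !ffunE Dflat.
Qed.

Lemma th_ts_coef j a I : th j (ts j a) I = if j \in I then a I else 0.
Proof.
rewrite ffunE; case: ifP => // jI; rewrite ffunE !inE eqxx /= setD1K // scalerA.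
by rewrite (belowD j j I jI) ltnn sign_sqr scale1r.
Qed.

Lemma extu_Dt i j a : extu (D j) (t i *: a) =
  t i *: extu (D j) a + (if i == j then a else 0).
Proof.
apply/ffunP=> I; rewrite !ffunE Dt; congr (_ + _).
by case: eqP => _; rewrite ?ffunE.
Qed.

(** The Clifford relations leave the diagonal terms t_i D_i. The Leibniz terms from D_i acting on
    t_i add theta_i times its contraction, which together count the elements of I. *)
Lemma koszul_nabla a I :
  (koszul (nabla a) + nabla (koszul a)) I = #|I|%:R *: a I + eulerV (a I).
Proof.
have E1 : koszul (nabla a) = \sum_i \sum_j t i *: ts i (th j (extu (D j) a)).
  apply: eq_bigr => i _; rewrite (slin_sum (ts_slin i (phi := phi))) scaler_sumr.
  by [].
have E2 : nabla (koszul a) = \sum_i \sum_j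
    (t i *: th j (ts i (extu (D j) a)) + (if i == j then th j (ts j a) else 0)).
  rewrite exchange_big; apply: eq_bigr => j _ /=.
  rewrite (slin_sum (extu_slin (DS j))) (slin_sum (th_slin j (phi := phi))).
  apply: eq_bigr => i _; rewrite extu_Dt (slinD (th_slin j (phi := phi))) thZ.
  rewrite (extu_ts (DS j)); congr (_ + _); case: eqP => [->|] //.
  by rewrite (slin0 (th_slin j (phi := phi))).
have -> : koszul (nabla a) + nabla (koszul a) =
    \sum_i t i *: extu (D i) a + \sum_i th i (ts i a).
  rewrite E1 E2 -!big_split; apply: eq_bigr => i _ /=.
  rewrite -big_split /=.
  under eq_bigr => j _ do rewrite addrA -scalerDr ts_th.
  rewrite big_split /= (bigD1 i) //= eqxx big1 ?addr0; last first.
    by move=> j; rewrite eq_sym => /negbTE ->; rewrite scaler0.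
  congr (_ + _); rewrite (bigD1 i) //= eqxx big1 ?addr0 // => j.
  by rewrite eq_sym => /negbTE ->.
rewrite addrC ffunE !sum_ffunE; congr (_ + _); last first.
  by apply: eq_bigr => j _; rewrite !ffunE.
under eq_bigr => j _ do rewrite th_ts_coef.
by rewrite -big_mkcond sumr_const scaler_nat.
Qed.

Definition positive a : A := [ffun I => if I == set0 then 0 else a I].

Lemma positive_id a : a set0 = 0 -> positive a = a.
Proof. by move=> a0; apply/ffunP=> I; rewrite ffunE; case: eqP => // ->. Qed.

Lemma laplace_green a : koszul (nabla (green a)) + nabla (koszul (green a)) = positive a.
Proof.
apply/ffunP=> I; rewrite koszul_nabla !ffunE; case: eqP => [->|/eqP I0].
  by rewrite cards0 scale0r add0r (slin0 eulerV_slin).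
by rewrite gE // card_gt0.
Qed.

Lemma green_laplace a : green (koszul (nabla a) + nabla (koszul a)) = positive a.
Proof.
apply/ffunP=> I; rewrite [LHS]ffunE koszul_nabla ffunE; case: eqP => // /eqP I0.
by rewrite Eg // card_gt0.
Qed.

Lemma green_coef0 a : green a set0 = 0.
Proof. by rewrite ffunE eqxx. Qed.

Lemma nabla_coef0 a : nabla a set0 = 0.
Proof. by rewrite sum_ffunE big1 // => j _; rewrite th_coef0. Qed.

(** As [nabla] squares to zero, it commutes with the Laplacian and so with its inverse; the
    degree-zero part has to be dropped, as [green] does. *)
Lemma nabla_green a : nabla (green a) = green (nabla (positive a)).
Proof.
rewrite -laplace_green (slinD nabla_slin) nabla_nabla addr0.
rewrite -{1}(positive_id (nabla (green a))) ?nabla_coef0 // -green_laplace.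
by rewrite nabla_nabla (slin0 koszul_slin) add0r.
Qed.

Lemma nabla_contraction a : nabla (contraction a) = 0.
Proof.
rewrite nabla_green positive_id ?nabla_coef0 // nabla_nabla.
exact: slin0 green_slin.
Qed.

Lemma contraction_contraction a : contraction (contraction a) = 0.
Proof. by rewrite {1}/contraction nabla_contraction (slin0 green_slin). Qed.

Lemma contraction_coef0 a : contraction a set0 = 0.
Proof. exact: green_coef0. Qed.

Local Notation Pi := (residue A koszul contraction).

Lemma residue_slin : slin Pi.
Proof.
apply: slin_add; last first.
  by apply/slin_opp/slin_comp; [exact: contraction_slin|exact: koszul_slin].
apply: slin_add; first exact: slin_id.
by apply/slin_opp/slin_comp; [exact: koszul_slin|exact: contraction_slin].
Qed.

Lemma nabla_residue a : nabla (Pi a) = 0.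
Proof.
rewrite /residue !(slinB nabla_slin) nabla_contraction subr0.
have E := laplace_green (nabla a).
rewrite positive_id ?nabla_coef0 // -/(contraction a) nabla_contraction in E.
by rewrite (slin0 koszul_slin) add0r in E; rewrite E subrr.
Qed.

(** Away from degree zero [koszul] commutes with [green], so the two terms of the homotopy add up to
    [green] of the Laplacian, the identity there. *)
Lemma residue_positive a : a set0 = 0 -> Pi a = 0.
Proof.
move=> a0; rewrite /residue /contraction.
have -> : green (nabla (koszul a)) = a - green (koszul (nabla a)).
  by rewrite -{2}(positive_id a a0) -green_laplace (slinD green_slin) addrAC subrr add0r.
set b := nabla a.
(* Since a vanishes in degree zero, b starts in degree two, so [koszul (green b)] starts in degree
   one and [positive] fixes it. *)
have z : koszul (green b) set0 = 0.
  rewrite sum_ffunE big1 // => j _; rewrite !ffunE inE setU0.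
  case: ifP => _; rewrite ?scaler0 //.
  rewrite cards1 /b sum_ffunE (_ : \sum_i _ = 0) ?(slin0 (g_slin 1 _)) ?scaler0 //.
  apply: big1 => i _; rewrite ffunE; case: ifP => //; rewrite inE => /eqP ->.
  by rewrite setDv ffunE a0 (slin0 (DS j)) scaler0.
have <- : koszul (green b) = green (koszul b).
  rewrite -[LHS](positive_id _ z) -green_laplace koszul_koszul (slin0 nabla_slin).
  rewrite addr0; congr green; rewrite -{2}(positive_id b) ?nabla_coef0 //.
  by rewrite -laplace_green (slinD koszul_slin) koszul_koszul add0r.
by rewrite subrr.
Qed.

(** This lets an element of K be replaced by its degree-zero coefficient, the key to composing psi
    with vartheta. *)
Lemma residue_inc0 a : Pi a = Pi (inc0 (a set0)).
Proof.
apply/eqP; rewrite -subr_eq0 -(slinB residue_slin) residue_positive //.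
by rewrite !ffunE eqxx subrr.
Qed.

Lemma nabla_pure k a : pure k a -> pure k.+1 (nabla a).
Proof.
move=> ak; apply: pure_sum => j; apply: th_pure => I Ik.
by rewrite ffunE ak // (slin0 (DS j)).
Qed.

Lemma nabla_degge k a : degge k a -> degge k.+1 (nabla a).
Proof.
move=> ak; apply: degge_sum => j; apply: th_degge => I Ik.
by rewrite ffunE ak // (slin0 (DS j)).
Qed.

Lemma green_pure k a : pure k a -> pure k (green a).
Proof.
move=> ak I Ik; rewrite ffunE; case: eqP => // /eqP I0.
by rewrite ak // (slin0 (g_slin _ _)) // card_gt0.
Qed.

Lemma green_degge k a : degge k a -> degge k (green a).
Proof.
move=> ak I Ik; rewrite ffunE; case: eqP => // /eqP I0.
by rewrite ak // (slin0 (g_slin _ _)) // card_gt0.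
Qed.

Lemma koszul_pure k a : pure k.+1 a -> pure k (koszul a).
Proof.
move=> ak; apply: pure_sum => j I Ik.
by rewrite ffunE (ts_pure _ _ _ ak) // scaler0.
Qed.

Lemma koszul_inc0 v : koszul (inc0 v) = 0.
Proof. by rewrite /koszul big1 // => j _; rewrite ts_inc0 scaler0. Qed.

Lemma koszul_top a : koszul a [set: 'I_n] = 0.
Proof.
by rewrite sum_ffunE big1 // => j _; rewrite !ffunE inE scaler0.
Qed.

Lemma residue_inc0_pure v : pure 0 (Pi (inc0 v)).
Proof.
rewrite /residue koszul_inc0 (slin0 contraction_slin) subr0 => I I0.
have h0 : pure 0 (koszul (contraction (inc0 v))).
  by apply/koszul_pure/green_pure/nabla_pure/inc0_pure.
by rewrite fcoefB h0 // inc0_pure // subrr.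
Qed.

(** t_j v is the Koszul boundary of theta_j v, which has positive degree and hence residue zero; the
    residue of its boundary then vanishes too. So the projection factors through X/tX. *)
Lemma residue_t j v : Pi (inc0 (t j *: v)) = 0.
Proof.
set a : A := th j (inc0 v).
have Ea : inc0 (t j *: v) = koszul a.
  rewrite /koszul (bigD1 j) //= big1 ?addr0 => [|i ij].
    have := ts_th j j (inc0 v); rewrite eqxx ts_inc0.
    rewrite (slin0 (th_slin j (phi := phi))) addr0 -/a => ->.
    by apply/ffunP=> I; rewrite !ffunE; case: ifP => _; rewrite ?scaler0.
  have := ts_th i j (inc0 v); rewrite (negbTE ij) ts_inc0.
  by rewrite (slin0 (th_slin j (phi := phi))) addr0 -/a => ->; rewrite scaler0.
have := residue_positive a (th_coef0 _ _); rewrite /residue => /eqP.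
rewrite subr_eq0 subr_eq => /eqP {}Ha.
rewrite Ea /residue koszul_koszul (slin0 contraction_slin) subr0 -(slinB koszul_slin).
have -> : a - contraction (koszul a) = koszul (contraction a).
  by rewrite {1}Ha addrAC subrr add0r.
exact: koszul_koszul.
Qed.

(** * Perturbing the Koszul differential by d *)

Section Perturbed.
Variable d : V -> V.
Hypothesis dS : slin d.
Hypothesis dt : forall i v, d (t i *: v) = t i *: d v.
Variable W : S.
Hypothesis dd : forall v, d (d v) = phi W *: v.

Definition step a := - contraction (ext d a).
(** The geometric series for the inverse of 1 + H d. It stops at k = n because each step raises the
    exterior degree. *)
Definition neumann a := \sum_(k < n.+1) iter k step a.

Lemma step_slin : slin step.
Proof. apply/slin_opp/slin_comp; [exact: contraction_slin | exact: ext_slin]. Qed.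

Lemma neumann_slin : slin neumann.
Proof. by apply: slin_bigsum => k; apply/slin_iter/step_slin. Qed.

Lemma step_degge k a : degge k a -> degge k.+1 (step a).
Proof.
move=> ak I Ik; rewrite ffunE; have -> : contraction (ext d a) I = 0; last exact: oppr0.
apply: green_degge Ik; apply: nabla_degge => J Jk.
by rewrite ffunE ak // (slin0 dS) scaler0.
Qed.

Lemma step_pure k a : pure k a -> pure k.+1 (step a).
Proof.
move=> ak I Ik; rewrite ffunE; have -> : contraction (ext d a) I = 0; last exact: oppr0.
apply: green_pure Ik; apply: nabla_pure => J Jk.
by rewrite ffunE ak // (slin0 dS) scaler0.
Qed.

Lemma iter_step_eq0 a : iter n.+1 step a = 0.
Proof.
apply: degge_eq0; elim: n.+1 => [|k IH]; first by move=> I; rewrite ltn0.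
exact: step_degge.
Qed.

Lemma neumann_step a : neumann a - step (neumann a) = a.
Proof.
rewrite (slin_sum step_slin) -sumrB.
rewrite -(big_mkord xpredT (fun k => iter k step a - step (iter k step a))).
have E m : \sum_(0 <= k < m) (iter k step a - step (iter k step a)) = a - iter m step a.
  elim: m => [|m IH]; first by rewrite big_nil subrr.
  by rewrite big_nat_recr //= IH addrA addrNK.
by rewrite E iter_step_eq0 subr0.
Qed.

Lemma step_neumann a : step (neumann a) = neumann (step a).
Proof.
rewrite (slin_sum step_slin); apply: eq_bigr => k _.
by rewrite -iterS iterSr.
Qed.

Definition total a := ext d a + koszul a.

Lemma ext_dd a : ext d (ext d a) = phi W *: a.
Proof. by rewrite (ext_ext _ _ _ dS); apply/ffunP=> I; rewrite !ffunE dd. Qed.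

Lemma ext_koszul (f : V -> V) a : slin f -> (forall i v, f (t i *: v) = t i *: f v) ->
  ext f (koszul a) = - koszul (ext f a).
Proof.
move=> fS ft; rewrite (slin_sum (ext_slin fS)) -sumrN; apply: eq_bigr => j _.
rewrite -scalerN -(ext_ts fS).
by apply/ffunP=> I; rewrite !ffunE ft !scalerA mulrC.
Qed.

Lemma neumann_contraction_coef0 a : neumann (contraction a) set0 = 0.
Proof.
rewrite -[neumann _](subrK (step (neumann (contraction a)))) neumann_step.
by rewrite fcoefD fcoefN !contraction_coef0 oppr0 addr0.
Qed.

Lemma residue_neumann a : Pi (ext d (neumann (contraction a))) = 0.
Proof.
apply: residue_positive.
by rewrite ffunE neumann_contraction_coef0 (slin0 dS) scaler0.
Qed.

Let neumannK a : neumann (a + contraction (ext d a)) = a.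
Proof.
have -> : a + contraction (ext d a) = a - step a by rewrite opprK.
by rewrite (slinB neumann_slin) -step_neumann neumann_step.
Qed.

Let Kneumann a : neumann a + contraction (ext d (neumann a)) = a.
Proof. by rewrite -[RHS]neumann_step /step opprK. Qed.

(** The perturbation lemma with [neumann] as T. Its condition on the residue holds because [neumann]
    of a contraction has no component in degree zero. *)
Lemma homotopy_formula a : neumann (Pi a) =
  a - total (neumann (contraction a)) - neumann (contraction (total a)).
Proof.
apply: (perturbation phi A W (ext d) koszul contraction neumann) => //.
- exact: ext_slin.
- exact: koszul_slin.
- exact: contraction_slin.
- exact: neumann_slin.
- exact: ext_dd.
- by move=> x; exact: ext_koszul.
- exact: contraction_contraction.
- exact: residue_neumann.
Qed.

Lemma total_neumann a : total (neumann (Pi a)) = neumann (Pi (total a)).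
Proof.
apply: (perturbation_comm phi A W (ext d) koszul contraction neumann) => //.
- exact: ext_slin.
- exact: koszul_slin.
- exact: contraction_slin.
- exact: neumann_slin.
- exact: ext_dd.
- exact: koszul_koszul.
- by move=> x; exact: ext_koszul.
- exact: contraction_contraction.
- exact: residue_neumann.
Qed.

(** * The maps between X/tX and X[n] *)

Variable lam : 'I_n -> V -> V.
Hypothesis lamS : forall j, slin (lam j).
Hypothesis lamt : forall j i v, lam j (t i *: v) = t i *: lam j v.
Hypothesis lamd : forall j v, lam j (d v) + d (lam j v) = t j *: v.

Definition koprod a := foldr (thlam lam) a (enum 'I_n).
(** The future psi; [sect] is the future vartheta, and [sect_homotopy] the homotopy between their
    composite and the identity of X[n]. *)
Definition retr v := neumann (Pi (inc0 v)) [set: 'I_n].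
Definition sect v := koprod (inc0 v) set0.
Definition sect_homotopy v := - neumann (contraction (koprod (inc0 v))) [set: 'I_n].

Lemma thlam_slin j : slin (thlam lam j).
Proof. by apply: slin_add; [exact: th_slin | apply/slin_opp/ext_slin]. Qed.

Lemma koprod_slin : slin koprod.
Proof. exact: slin_foldr thlam_slin. Qed.

Lemma retr_slin : slin retr.
Proof.
apply: (slin_comp (fun a : A => a [set: 'I_n]) (fun v => neumann (Pi (inc0 v)))).
  exact: coef_slin.
apply: slin_comp; first exact: neumann_slin.
by apply: slin_comp; [exact: residue_slin | exact: inc0_slin].
Qed.

Lemma sect_slin : slin sect.
Proof.
apply: (slin_comp (fun a : A => a set0) (fun v => koprod (inc0 v))).
  exact: coef_slin.
by apply: slin_comp; [exact: koprod_slin | exact: inc0_slin].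
Qed.

Lemma sect_homotopy_slin : slin sect_homotopy.
Proof.
apply/slin_opp/(slin_comp (fun a : A => a [set: 'I_n])
  (fun v => neumann (contraction (koprod (inc0 v))))); first exact: coef_slin.
apply: slin_comp; first exact: neumann_slin.
apply: slin_comp; first exact: contraction_slin.
by apply: slin_comp; [exact: koprod_slin | exact: inc0_slin].
Qed.

Lemma koszul_th j a : koszul (th j a) = t j *: a - th j (koszul a).
Proof.
apply/eqP; rewrite -subr_eq opprK; apply/eqP.
rewrite (slin_sum (th_slin j (phi := phi))) -big_split /=.
rewrite (bigD1 j) //= thZ -scalerDr ts_th eqxx big1 ?addr0 // => i ij.
by rewrite thZ -scalerDr ts_th (negbTE ij) scaler0.
Qed.

Lemma ext_d_lam j a : ext d (ext (lam j) a) = t j *: a - ext (lam j) (ext d a).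
Proof.
rewrite (ext_ext _ _ _ dS) (ext_ext _ _ _ (lamS j)).
by apply/ffunP=> I; rewrite !ffunE -lamd addrAC subrr add0r.
Qed.

(** The t_j produced by theta_j and [koszul] cancels the t_j produced by lambda_j and d. *)
Lemma thlam_total j a : total (thlam lam j a) = - thlam lam j (total a).
Proof.
rewrite /total /thlam (slinB (ext_slin dS)) (slinB koszul_slin).
rewrite (slinD (th_slin j (phi := phi))) (slinD (ext_slin (lamS j))).
rewrite (ext_th dS) ext_d_lam koszul_th.
have -> : koszul (ext (lam j) a) = - ext (lam j) (koszul a).
  by rewrite ext_koszul ?opprK //; exact: lamS.
move: (th j (ext d a)) (ext (lam j) (ext d a)) => x y.
move: (th j (koszul a)) (ext (lam j) (koszul a)) => z u.
rewrite opprK opprB !addrA addrNK opprB opprD [RHS]addrC !addrA.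
by rewrite [- x + y - z]addrAC.
Qed.

Lemma total_inc0 v : total (inc0 v) = inc0 (d v).
Proof. by rewrite /total koszul_inc0 addr0 (ext_inc0 dS). Qed.

Lemma total_koprod v : total (koprod (inc0 v)) = (-1) ^+ n *: koprod (inc0 (d v)).
Proof.
have E w : total (foldr (thlam lam) (inc0 v) w) =
    (-1) ^+ size w *: foldr (thlam lam) (inc0 (d v)) w.
  elim: w => [|j w IH] /=; first by rewrite scale1r total_inc0.
  rewrite thlam_total IH (slin_sign (thlam_slin j)).
  by rewrite exprS -scalerA scaleN1r.
by rewrite /koprod E size_enum_ord.
Qed.

(** Nothing lies above the top degree, so [koszul] does not reach it. The remaining sign is that of
    the differential of X[n]. *)
Lemma total_top a : total a [set: 'I_n] = (-1) ^+ n *: d (a [set: 'I_n]).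
Proof. by rewrite fcoefD koszul_top addr0 ffunE cardsT card_ord. Qed.

Lemma koprod_top v : koprod (inc0 v) [set: 'I_n] = v.
Proof.
by rewrite -[RHS](thlam_coef lam lamS (enum 'I_n) v sorted_enum_ord).1 set_enum_ord.
Qed.

Lemma sectE v : sect v = (-1) ^+ n *: foldr lam v (enum 'I_n).
Proof. by rewrite /sect /koprod (thlam_coef0 _ lamS) size_enum_ord. Qed.

Lemma retr_d v : retr (d v) = (-1) ^+ n *: d (retr v).
Proof. by rewrite /retr -total_inc0 -total_neumann total_top. Qed.

Lemma retr_t j v : retr (t j *: v) = 0.
Proof. by rewrite /retr residue_t (slin0 neumann_slin) ffunE. Qed.

(** By [residue_inc0] the degree-zero coefficient may be replaced by the whole product, to which
    [homotopy_formula] applies; its top coefficient is v. *)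
Lemma retr_sect v : retr (sect v) - v =
  (-1) ^+ n *: d (sect_homotopy v) + sect_homotopy ((-1) ^+ n *: d v).
Proof.
rewrite /retr /sect -residue_inc0 homotopy_formula !fcoefB koprod_top total_top.
rewrite total_koprod (slin_sign contraction_slin) (slin_sign neumann_slin).
rewrite (slin_sign sect_homotopy_slin) /sect_homotopy (slinN dS) !scalerN.
rewrite [((-1) ^+ n *: neumann _) _]ffunE.
by rewrite [LHS]addrC !addrA addNr add0r.
Qed.

(** * Congruence modulo t *)

Definition modt v := exists w : 'I_n -> V, v = \sum_j t j *: w j.

Lemma modt0 : modt 0.
Proof. by exists (fun=> 0); rewrite big1 // => j _; rewrite scaler0. Qed.

Lemma modtD u v : modt u -> modt v -> modt (u + v).
Proof.
move=> [x ->] [y ->]; exists (fun j => x j + y j).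
by rewrite -big_split; apply: eq_bigr => j _; rewrite scalerDr.
Qed.

Lemma modtZ r v : modt v -> modt (r *: v).
Proof.
move=> [x ->]; exists (fun j => r *: x j); rewrite scaler_sumr.
by apply: eq_bigr => j _; rewrite !scalerA mulrC.
Qed.

Lemma modtN v : modt v -> modt (- v).
Proof. by rewrite -scaleN1r; apply: modtZ. Qed.

Lemma modt_tlinear f v : slin f -> (forall i u, f (t i *: u) = t i *: f u) ->
  modt v -> modt (f v).
Proof.
move=> fS ft [w ->]; exists (fun j => f (w j)).
by rewrite (slin_sum fS); apply: eq_bigr => j _; rewrite ft.
Qed.

Lemma modt_sum (r : seq 'I_n) (F : 'I_n -> V) :
  (forall j, modt (F j)) -> modt (\sum_(j <- r) F j).
Proof.
move=> Fm; elim: r => [|j r IH]; first by rewrite big_nil; exact: modt0.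
by rewrite big_cons; apply: modtD.
Qed.

Lemma retr_modt v : modt v -> retr v = 0.
Proof.
by case=> w ->; rewrite (slin_sum retr_slin) big1 // => j _; exact: retr_t.
Qed.

Lemma foldr_lamt i v w : foldr lam (t i *: v) w = t i *: foldr lam v w.
Proof. by elim: w => //= j w ->. Qed.

Lemma sect_t i v : sect (t i *: v) = t i *: sect v.
Proof. by rewrite !sectE foldr_lamt !scalerA mulrC. Qed.

Lemma sect_modt v : modt v -> modt (sect v).
Proof. by apply: modt_tlinear; [exact: sect_slin | exact: sect_t]. Qed.

Lemma koszul_modt a I : modt (koszul a I).
Proof.
exists (fun j => ts j a I).
by rewrite sum_ffunE; apply: eq_bigr => j _; rewrite ffunE.
Qed.

(** The product is compatible with [total] exactly; in degree zero [total] differs from d by a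
    Koszul term, which lies in tV. *)
Lemma sect_d v : modt (sect ((-1) ^+ n *: d v) - d (sect v)).
Proof.
have -> : sect ((-1) ^+ n *: d v) = total (koprod (inc0 v)) set0.
  by rewrite total_koprod (slin_sign sect_slin) ffunE.
rewrite fcoefD ffunE cards0 scale1r addrAC subrr add0r.
exact: koszul_modt.
Qed.

(** * The Atiyah class modulo t *)

Definition at_comp j v := d (D j v) - D j (d v).

Lemma at_comp_slin j : slin (at_comp j).
Proof.
by apply: slin_add; [exact: slin_comp | apply: slin_opp; exact: slin_comp].
Qed.

(** The Leibniz term arises once before and once after d, and cancels in the commutator. *)
Lemma at_comp_t j i v : at_comp j (t i *: v) = t i *: at_comp j v.
Proof.
rewrite /at_comp dt !Dt (slinD dS) dt scalerBr; case: (i == j).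
  by rewrite opprD addrACA subrr addr0.
by rewrite (slin0 dS) !addr0.
Qed.

Local Notation Q := (atiyah at_comp).

Lemma atiyahE a : Q a = - (ext d (nabla a) + nabla (ext d a)).
Proof.
rewrite (slin_sum (ext_slin dS)) -big_split -sumrN; apply: eq_bigr => j _ /=.
rewrite (ext_th dS) opprD opprK (extu_ext _ _ _ (DS j)) ext_extu.
rewrite -(slinB (th_slin j (phi := phi))).
by congr th; apply/ffunP=> I; rewrite !ffunE scalerBr.
Qed.

Lemma atiyah_modt a : (forall I, modt (a I)) -> forall I, modt (Q a I).
Proof.
move=> am I; rewrite sum_ffunE; apply: modt_sum => j; rewrite ffunE.
case: ifP => _; last exact: modt0.
apply: modtZ; rewrite ffunE; apply: modtZ.
by apply: modt_tlinear; [exact: at_comp_slin | exact: at_comp_t | exact: am].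
Qed.

Lemma atiyah_slin : slin Q.
Proof.
apply: slin_bigsum => j; apply: slin_comp; first exact: th_slin.
exact: ext_slin (at_comp_slin j).
Qed.

(** In degree k+1 [green] inverts k+1 + sum_j t_j D_j, and the sum takes values in tV. *)
Lemma green_modt k a I : pure k.+1 a -> modt (k.+1%:R *: green a I - a I).
Proof.
move=> ak; have [Ik|Ik] := eqVneq #|I| k.+1; last first.
  by rewrite (green_pure _ _ ak) // ak // scaler0 subrr; exact: modt0.
have I0 : I != set0 by rewrite -card_gt0 Ik.
rewrite ffunE (negbTE I0) Ik -{2}(gE k.+1 (a I)) // opprD addrA subrr add0r.
by apply: modtN; exists (fun j => D j (g k.+1 (a I))).
Qed.

Lemma iter_step_pure k v : pure k (iter k step (Pi (inc0 v))).
Proof. by elim: k => [|k IH]; [exact: residue_inc0_pure | exact: step_pure]. Qed.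

Lemma nabla_iter_step k v : nabla (iter k step (Pi (inc0 v))) = 0.
Proof.
case: k => [|k]; first exact: nabla_residue.
by rewrite iterS /step (slinN nabla_slin) nabla_contraction oppr0.
Qed.

(* The iterates lie in the kernel of nabla, where Q = - nabla d; and [green] is
   1/k modulo t in degree k, whence the k!. *)
Lemma iter_step_modt k v I :
  modt ((k`!%:R *: iter k step (Pi (inc0 v)) - iter k Q (inc0 v)) I).
Proof.
elim: k I => [|k IH] I.
  rewrite fact0 scale1r /= /residue koszul_inc0 (slin0 contraction_slin) subr0.
  by rewrite addrAC subrr add0r fcoefN; apply/modtN/koszul_modt.
set z := iter k step _ in IH *.
have zk : pure k z by exact: iter_step_pure.
have Qz : Q z = - nabla (ext d z).
  by rewrite atiyahE nabla_iter_step (slin0 (ext_slin dS)) add0r.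
have dzk : pure k.+1 (nabla (ext d z)).
  by apply: nabla_pure => J Jk; rewrite ffunE zk // (slin0 dS) scaler0.
(* The new error is that of [green] in one step plus Q applied to the old error; Q is linear over
   the t_j, so it preserves tV. *)
have -> : (k.+1)`!%:R *: iter k.+1 step (Pi (inc0 v)) - iter k.+1 Q (inc0 v) =
    k`!%:R *: - (k.+1%:R *: contraction (ext d z) - nabla (ext d z)) +
    Q (k`!%:R *: z - iter k Q (inc0 v)).
  rewrite (slinB atiyah_slin) (slin_nat atiyah_slin) Qz addrA; congr (_ - _).
  rewrite -scalerDr opprB addrAC subrr add0r factS mulnC natrM -scalerA.
  by rewrite -scalerN.
rewrite fcoefD; apply: modtD; last exact: atiyah_modt.
rewrite ffunE; apply: modtZ; rewrite fcoefN fcoefB; apply: modtN.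
rewrite [(_ *: contraction _) _]ffunE; exact: green_modt.
Qed.

(** The k-th term of the series is pure of degree k, so only the last one reaches the top. *)
Lemma retrE v : retr v = iter n step (Pi (inc0 v)) [set: 'I_n].
Proof.
rewrite /retr sum_ffunE big_ord_recr /= big1 ?add0r // => k _.
by rewrite iter_step_pure // cardsT card_ord gtn_eqF.
Qed.

Definition atiyah_power v :=
  \sum_(s : 'S_n) (-1) ^+ s *: foldr at_comp v [seq s i | i <- enum 'I_n].

Lemma sect_retr v : n`!%:R \is a @GRing.unit S ->
  modt (sect (retr v) - phi (n`!%:R^-1 * (-1) ^+ 'C(n.+1, 2)) *:
    foldr lam (atiyah_power v) (enum 'I_n)).
Proof.
move=> nU; have lS : slin (fun u => foldr lam u (enum 'I_n)) by exact: slin_foldr.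
(* First psi alone: the n-th iterate is the n-th Atiyah power over n! modulo t, with the sign C(n,2)
   of the reordering. *)
have : modt (retr v - phi (n`!%:R^-1 * (-1) ^+ 'C(n, 2)) *: atiyah_power v).
  have := iter_step_modt n v [set: 'I_n].
  rewrite fcoefB ffunE -retrE (top_iter_atiyah _ at_comp_slin) //.
  move=> /(modtZ (phi n`!%:R^-1)).
  rewrite scalerBr !scalerA -(rmorph_nat phi) -rmorphM mulVr // rmorph1 scale1r.
  by rewrite rmorphM rmorphXn rmorphN1.
move/(modt_tlinear _ _ lS (fun i u => foldr_lamt i u _))/(modtZ ((-1) ^+ n)).
rewrite (slinB lS) (slinZ lS) scalerBr -sectE scalerA.
(* The sign (-1)^n of [sect] joins that of the reordering, as C(n+1,2) = C(n,2) + n. *)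
rewrite (_ : (-1) ^+ n * _ = phi (n`!%:R^-1 * (-1) ^+ 'C(n.+1, 2))) //.
by rewrite binS bin1 exprD !rmorphM !rmorphXn rmorphN1 mulrC -mulrA.
Qed.

(** * Compatibility with the grading *)

Variable p : bool -> V -> V.
Hypothesis pS : forall b, slin (p b).
Hypothesis pt : forall b i v, p b (t i *: v) = t i *: p b v.
Hypothesis pd : forall b v, d (p b v) = p (~~ b) (d v).
Hypothesis plam : forall b j v, lam j (p b v) = p (~~ b) (lam j v).
Hypothesis pD : forall b j v, D j (p b v) = p b (D j v).

(** The projection to total parity b, each theta_j counting as odd. *)
Definition parity b a : A := [ffun I : {set 'I_n} => p (b (+) odd #|I|) (a I)].

Lemma parity_slin b : slin (parity b).
Proof. by move=> s x y; apply/ffunP=> I; rewrite !ffunE pS. Qed.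

Lemma parityZ b j a : parity b (t j *: a) = t j *: parity b a.
Proof. by apply/ffunP=> I; rewrite !ffunE pt. Qed.

Lemma th_parity b j a : th j (parity b a) = parity (~~ b) (th j a).
Proof.
apply/ffunP=> I; rewrite !ffunE; case: ifP => jI; last by rewrite (slin0 (pS _)).
by rewrite (slin_sign (pS _)) [in RHS](cardsD1 j) jI /= addbN addNb negbK.
Qed.

Lemma ts_parity b j a : ts j (parity b a) = parity (~~ b) (ts j a).
Proof.
apply/ffunP=> I; rewrite !ffunE; case: ifP => jI; first by rewrite (slin0 (pS _)).
by rewrite (slin_sign (pS _)) cardsU1 jI /= addbN addNb.
Qed.

Lemma ext_parity b (f : V -> V) a : (forall c v, f (p c v) = p (~~ c) (f v)) ->
  ext f (parity b a) = parity (~~ b) (ext f a).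
Proof.
move=> pf; apply/ffunP=> I; rewrite !ffunE pf (slin_sign (pS _)).
by rewrite addNb.
Qed.

Lemma koszul_parity b a : koszul (parity b a) = parity (~~ b) (koszul a).
Proof.
rewrite (slin_sum (parity_slin _)); apply: eq_bigr => j _.
by rewrite ts_parity parityZ.
Qed.

Lemma nabla_parity b a : nabla (parity b a) = parity (~~ b) (nabla a).
Proof.
rewrite (slin_sum (parity_slin _)); apply: eq_bigr => j _.
rewrite -th_parity; congr th; apply/ffunP=> I.
by rewrite !ffunE pD.
Qed.

(** The projection commutes with m + sum_j t_j D_j, hence with its inverse. *)
Lemma g_parity b m v : (0 < m)%N -> g m (p b v) = p b (g m v).
Proof.
move=> m0; rewrite -{1}(gE m v m0) (slinD (pS _)) (slin_nat (pS _)).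
have -> : p b (eulerV (g m v)) = eulerV (p b (g m v)).
  by rewrite (slin_sum (pS _)); apply: eq_bigr => j _; rewrite pt pD.
exact: Eg.
Qed.

Lemma green_parity b a : green (parity b a) = parity b (green a).
Proof.
apply/ffunP=> I; rewrite !ffunE; case: eqP => [_|/eqP I0].
  by rewrite (slin0 (pS _)).
by rewrite g_parity // card_gt0.
Qed.

Lemma contraction_parity b a : contraction (parity b a) = parity (~~ b) (contraction a).
Proof. by rewrite /contraction nabla_parity green_parity. Qed.

Lemma step_parity b a : step (parity b a) = parity b (step a).
Proof.
by rewrite /step (ext_parity _ _ _ pd) contraction_parity negbK (slinN (parity_slin _)).
Qed.

Lemma neumann_parity b a : neumann (parity b a) = parity b (neumann a).
Proof.
rewrite (slin_sum (parity_slin _)); apply: eq_bigr => k _.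
by elim: (k : nat) => //= m ->; rewrite step_parity.
Qed.

Lemma residue_parity b a : Pi (parity b a) = parity b (Pi a).
Proof.
rewrite /residue !(slinB (parity_slin _)).
by rewrite contraction_parity !koszul_parity contraction_parity !negbK.
Qed.

Lemma inc0_parity b v : inc0 (p b v) = parity b (inc0 v).
Proof.
apply/ffunP=> I; rewrite !ffunE; case: eqP => [->|_]; last by rewrite (slin0 (pS _)).
by rewrite cards0 addbF.
Qed.

Lemma koprod_parity b a : koprod (parity b a) = parity (b (+) odd n) (koprod a).
Proof.
have E w : foldr (thlam lam) (parity b a) w =
    parity (b (+) odd (size w)) (foldr (thlam lam) a w).
  elim: w => [|j w IH] /=; first by rewrite addbF.
  rewrite IH addbN /thlam (slinB (parity_slin _)) th_parity.
  by rewrite (ext_parity _ _ _ (fun c v => plam c j v)).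
by rewrite /koprod E size_enum_ord.
Qed.

Lemma parity_top b a : parity b a [set: 'I_n] = p (b (+) odd n) (a [set: 'I_n]).
Proof. by rewrite ffunE cardsT card_ord. Qed.

Lemma retr_parity b v : retr (p b v) = p (b (+) odd n) (retr v).
Proof.
by rewrite /retr inc0_parity residue_parity neumann_parity parity_top.
Qed.

Lemma sect_parity b v : sect (p b v) = p (b (+) odd n) (sect v).
Proof. by rewrite /sect inc0_parity koprod_parity ffunE cards0 addbF. Qed.

Lemma sect_homotopy_parity b v :
  sect_homotopy (p b v) = p (~~ b) (sect_homotopy v).
Proof.
rewrite /sect_homotopy inc0_parity koprod_parity contraction_parity neumann_parity.
by rewrite parity_top (slinN (pS _)) addNb -addbA addbb addbF.
Qed.

(** A summary from which the exterior algebra has disappeared. X/tX is the source of psi, so psi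
    must kill tV; it is the target of vartheta, so vartheta need be a chain map only modulo t. *)
Lemma koszul_retract : n`!%:R \is a @GRing.unit S ->
  exists psi theta h : V -> V,
  [/\ [/\ slin psi, slin theta & slin h],
      [/\ forall b v, psi (p b v) = p (b (+) odd n) (psi v),
          forall b v, theta (p b v) = p (b (+) odd n) (theta v) &
          forall b v, h (p b v) = p (~~ b) (h v)],
      [/\ forall v, modt v -> psi v = 0,
          forall v, modt v -> modt (theta v),
          forall v, psi (d v) = (-1) ^+ n *: d (psi v) &
          forall v, modt (theta ((-1) ^+ n *: d v) - d (theta v))],
      forall v, psi (theta v) - v =
        (-1) ^+ n *: d (h v) + h ((-1) ^+ n *: d v) &
      forall v, modt (theta (psi v) - phi (n`!%:R^-1 * (-1) ^+ 'C(n.+1, 2)) *: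
        foldr lam (atiyah_power v) (enum 'I_n))].
Proof.
move=> nU; exists retr, sect, sect_homotopy; split.
- by split; [exact: retr_slin | exact: sect_slin | exact: sect_homotopy_slin].
- split; [exact: retr_parity | exact: sect_parity | exact: sect_homotopy_parity].
- by split; [exact: retr_modt | exact: sect_modt | exact: retr_d | exact: sect_d].
- exact: retr_sect.
- by move=> v; exact: sect_retr.
Qed.

End Perturbed.
End KoszulContraction.

(** * Column vectors over R *)

Section ConnectionBasics.
Context {S : comUnitRingType} {R : comNzRingType} {phi : {rmorphism S -> R}}.
Context {n : nat} {t : 'I_n -> R} {del : 'I_n -> R -> R}.
Hypothesis delP : is_connection phi t del.

(** The Leibniz rule for a constant polynomial, whose derivative is zero. *)
Lemma connection_const j s x y : del j (phi s * x + y) = phi s * del j x + del j y.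
Proof.
case: delP => delD delM; rewrite delD; congr (_ + _).
have := delM j (s%:MP_[n]) x; rewrite /tact map_mpolyC ?rmorph0 // mevalC => ->.
by rewrite mderivC rmorph0 meval0 mul0r addr0.
Qed.

Lemma connection0 j : del j 0 = 0.
Proof.
have := connection_const j (- 1) 0 0.
by rewrite rmorphN1 !mulN1r oppr0 addr0 addNr.
Qed.

Lemma connection_t i j x : del j (t i * x) = t i * del j x + (if i == j then x else 0).
Proof.
case: delP => delD delM.
have := delM j ('X_i : {mpoly S[n]}) x; rewrite /tact map_mpolyX mevalXU => ->.
congr (_ + _); rewrite mderivX mnm1E; case: eqP => [->|_]; last first.
  by rewrite scale0r rmorph0 meval0 mul0r.
have -> : (U_(j) - U_(j))%MM = 0%MM :> 'X_{1..n}.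
  by apply/mnmP=> k; rewrite mnmBE subnn mnm0E.
by rewrite scale1r mpolyX0 rmorph1 meval1 mul1r.
Qed.

End ConnectionBasics.

(** * Inverting p + sum_j t_j d/dt_j on R *)

Section GreenFunctions.
Context {R : comNzRingType} {n : nat} (t : 'I_n -> R) (del : 'I_n -> R -> R).
Hypothesis bij : forall m, bijective (fun r => m.+1%:R * r + euler t del r).

(** [bijective] is a mere proposition, so the inverse is picked by [xchoose], which needs this
    boolean equation. *)
Lemma euler_surj m r : exists r', m.+1%:R * r' + euler t del r' == r.
Proof. by have [f' _ fK] := bij m; exists (f' r); rewrite fK. Qed.

(** The value at m = 0 is a dummy: [green] calls its family in positive degree only. *)
Definition euler_inv m r : R := if m is m'.+1 then xchoose (euler_surj m' r) else 0.

Lemma euler_invE m r : (0 < m)%N ->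
  m%:R * euler_inv m r + euler t del (euler_inv m r) = r.
Proof. by case: m => // m _; exact: (eqP (xchooseP (euler_surj m r))). Qed.

Lemma euler_invK m r : (0 < m)%N -> euler_inv m (m%:R * r + euler t del r) = r.
Proof.
move=> m0; have [f' fK _] : bijective (fun r => m%:R * r + euler t del r).
  by case: m m0 => // m _; exact: bij.
by apply: (can_inj fK); exact: euler_invE.
Qed.

End GreenFunctions.

(** * Congruence and grading on columns *)

Section Columns.
Context {R : comNzRingType} {n : nat} (t : 'I_n -> R) (m0 m1 : nat).
Local Notation V := 'cV[R]_(m0 + m1).

Lemma modtP (v : V) : modt t v <-> forall i, inI t (v i 0).
Proof.
split=> [[w ->] i|vI].
  exists (fun j => w j i 0); rewrite summxE; apply: eq_bigr => j _.
  by rewrite mxE mulrC.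
have [c cP] := fin_all_exists vI.
exists (fun j => \col_i c i j); apply/colP=> i.
by rewrite cP summxE; apply: eq_bigr => j _; rewrite !mxE mulrC.
Qed.

Lemma vrel_modt (x y : V) : vrel t true x y <-> modt t (x - y).
Proof.
split=> [xy|/modtP xy i]; last by have := xy i; rewrite !mxE.
by apply/modtP=> i; rewrite !mxE; exact: xy.
Qed.

Lemma vrel_refl (q : bool) (x y : V) : x = y -> vrel t q x y.
Proof.
move=> ->; case: q => // i; exists (fun=> 0).
by rewrite subrr big1 // => j; rewrite mul0r.
Qed.

Lemma odd_projmx (B : 'M[R]_(m0, m1)) (C : 'M[R]_(m1, m0)) b :
  oddmx B C *m projmx R m0 m1 b = projmx R m0 m1 (~~ b) *m oddmx B C.
Proof.
by rewrite /oddmx /projmx; case: b => /=;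
  rewrite !mulmx_block !mulmx0 !mul0mx !mulmx1 !mul1mx ?addr0 ?add0r.
Qed.

Lemma map_projmx (f : R -> R) b (x : V) : f 0 = 0 ->
  map_mx f (projmx R m0 m1 b *m x) = projmx R m0 m1 b *m map_mx f x.
Proof.
move=> f0; have map0 m : map_mx f (0 : 'cV_m) = 0 by apply/matrixP=> i j; rewrite !mxE.
rewrite -[x]vsubmxK map_col_mx /projmx; case: b;
  by rewrite !mul_block_col !mul0mx !mul1mx ?addr0 ?add0r map_col_mx map0.
Qed.

Lemma comp_ordE (F : 'I_n -> V -> V) x : comp_ord F x = foldr F x (enum 'I_n).
Proof. by rewrite /comp_ord; elim: (enum _) => //= i w ->. Qed.

End Columns.

Theorem theorem10p1 (S : comUnitRingType) (R : comNzRingType)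
  (phi : {rmorphism S -> R}) (W : S) (n m0 m1 : nat)
  (D0 : 'M[R]_(m1, m0)) (D1 : 'M[R]_(m0, m1)) (t : 'I_n -> R)
  (L0 : 'I_n -> 'M[R]_(m0, m1)) (L1 : 'I_n -> 'M[R]_(m1, m0))
  (del : 'I_n -> R -> R) :
  (forall k : nat, (k.+1)%:R \is a @GRing.unit S) ->
  oddmx D1 D0 *m oddmx D1 D0 = (phi W)%:M ->
  quasi_regular t ->
  quot_fg_projective phi t ->
  (forall j, oddmx (L0 j) (L1 j) *m oddmx D1 D0
             + oddmx D1 D0 *m oddmx (L0 j) (L1 j) = (t j)%:M) ->
  is_connection phi t del ->
  is_standard t del ->
  let dX := oddmx D1 D0 in
  let XmodT := LFObj true 0 in
  let Xn := LFObj false n in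
  exists psi theta : 'cV[R]_(m0 + m1) -> 'cV[R]_(m0 + m1),
    [/\ is_lfmor phi t dX XmodT Xn psi,
        is_lfmor phi t dX Xn XmodT theta,
        homotopic phi t dX Xn Xn (psi \o theta) id &
        homotopic phi t dX XmodT XmodT (theta \o psi)
          (e_formula phi dX (fun j => oddmx (L0 j) (L1 j)) del)].
Proof.
move=> natU dd _ _ lamd delP [flat [bij _]] dX XmodT Xn.
pose V := 'cV[R]_(m0 + m1).
have bij' m : bijective (fun r => m.+1%:R * r + euler t del r).
  by have [] := bij m.+1 isT.
(* Both act coordinatewise: [D] is the connection attached to the standard basis, the one that [atc]
   uses. *)
pose D j : V -> V := map_mx (del j).
pose g m : V -> V := map_mx (euler_inv t del bij' m).
have mxS k (M : 'M[R]_(m0 + m1, k)) : slin phi (mulmx M : 'cV_k -> V).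
  by move=> s x y; rewrite mulmxDr scalemxAr.
have eulerV_col (v : V) i : eulerV t D v i 0 = euler t del (v i 0).
  by rewrite summxE; apply: eq_bigr => j _; rewrite !mxE.
have nfU : n`!%:R \is a @GRing.unit S.
  by case: n`! (fact_gt0 n) => // m _; exact: natU.
have DS j : slin phi (D j).
  by move=> s x y; apply/colP=> i; rewrite !mxE (connection_const delP).
have Dt i j (v : V) : D j (t i *: v) = t i *: D j v + (if i == j then v else 0).
  apply/colP=> k; rewrite !mxE (connection_t delP).
  by case: eqP => _; rewrite ?mxE.
have Dflat i j (v : V) : D i (D j v) = D j (D i v).
  by apply/colP=> k; rewrite !mxE flat.
have gE m (v : V) : (0 < m)%N -> m%:R *: g m v + eulerV t D (g m v) = v.
  by move=> mpos; apply/colP=> i; rewrite mxE eulerV_col !mxE euler_invE.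
have Eg m (v : V) : (0 < m)%N -> g m (m%:R *: v + eulerV t D v) = v.
  by move=> mpos; apply/colP=> i; rewrite !mxE eulerV_col euler_invK.
have dXX (v : V) : dX *m (dX *m v) = phi W *: v.
  by rewrite mulmxA dd mul_scalar_mx.
have lamX j (v : V) : oddmx (L0 j) (L1 j) *m (dX *m v)
    + dX *m (oddmx (L0 j) (L1 j) *m v) = t j *: v.
  by rewrite !mulmxA -mulmxDl lamd mul_scalar_mx.
have oddp (B : 'M[R]_(m0, m1)) (C : 'M[R]_(m1, m0)) b (v : V) :
    oddmx B C *m (projmx R m0 m1 b *m v) = projmx R m0 m1 (~~ b) *m (oddmx B C *m v).
  by rewrite mulmxA odd_projmx mulmxA.
have Dp b j (v : V) : D j (projmx R m0 m1 b *m v) = projmx R m0 m1 b *m D j v.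
  exact: map_projmx (connection0 delP j).
have [psi [theta [h [[psiS thetaS hS] [psip thetap hp]
    [psit thetat psid thetad] psitheta thetapsi]]]] :=
  koszul_retract t D g (natU 1) DS Dt Dflat gE Eg (mulmx dX) (mxS _ dX)
    (fun i v => esym (scalemxAr _ _ _)) W dXX
    (fun j => mulmx (oddmx (L0 j) (L1 j))) (fun j => mxS _ _)
    (fun j i v => esym (scalemxAr _ _ _)) lamX
    (fun b => mulmx (projmx R m0 m1 b)) (fun b => mxS _ _)
    (fun b i v => esym (scalemxAr _ _ _)) (oddp D1 D0) (fun b j => oddp _ _ b)
    Dp nfU.
exists psi, theta; split.
- split.
  + split=> [x y /vrel_modt/psit|s x y]; last exact: psiS.
    by rewrite (slinB psiS) => /eqP; rewrite subr_eq0 => /eqP.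
  + by move=> b x; rewrite /lf_proj /= !addbF psip.
  + by move=> x; rewrite /lf_d /= expr0 scale1r psid scalemxAl.
- split.
  + split=> [x y xy|s x y]; apply: vrel_refl; last exact: thetaS.
    by rewrite (xy : x = y).
  + move=> b x; apply: vrel_refl.
    (* The shift is on the source here, so n enters the parity twice and cancels. *)
    by rewrite /lf_proj /= !addbF thetap -addbA addbb addbF.
  + move=> x; apply/vrel_modt; rewrite /lf_d /= expr0 scale1r -scalemxAl.
    exact: thetad.
- exists h; split=> [|b x|x] /=.
  + by split=> [x y /= ->|s x y] //=; exact: hS.
  + by rewrite /lf_proj /= hp addbT addNb.
  + by rewrite /lf_d /= -!scalemxAl.
(* The formula for e holds on X/tX on the nose, so the zero homotopy is enough. *)
- exists (fun=> 0); split=> [|b x|x].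
  + by split=> [x y _|s x y]; apply: vrel_refl; rewrite // scaler0 addr0.
  + by apply: vrel_refl; rewrite mulmx0.
  + apply/vrel_modt; rewrite mulmx0 addr0 subr0 /e_formula comp_ordE.
    have <- : atiyah_power D (mulmx dX) x = atn dX del x.
      apply: eq_bigr => s _; rewrite comp_ordE; congr (_ *: _).
      by elim: (enum _) => //= i w ->.
    exact: thetapsi.
Qed.
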